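(* Let $\psi^{(A)}$ and $\psi^{(B)}$ be neighbor functions and let $\sigma^{(A)},\sigma^{(B)}$ be positive numbers. Then $\psi^{(A)}$ and $\psi^{(B)}$ are continuously differentiable almost everywhere. Set $\sigma^*=1$ and define $\psi^*$ by $$\frac{d\psi^*(x)}{dx}=\max\left(\frac{1}{\sigma^{(A)}}\frac{d\psi^{(A)}(x)}{dx},\ \frac{1}{\sigma^{(B)}}\frac{d\psi^{(B)}(x)}{dx}\right),\qquad \psi^*(x)=\int_0^x\frac{d\psi^*(s)}{ds}\,ds.$$ Then $\psi^*$ is a neighbor function, and for every $x\geq 0$ we have $I_{\psi^{(A)},\sigma^{(A)}}(x)\supseteq I_{\psi^*,\sigma^*}(x)$ and $I_{\psi^{(B)},\sigma^{(B)}}(x)\supseteq I_{\psi^*,\sigma^*}(x)$.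
   Context: A neighbor function is a function $\psi:\mathbb{R}_{\geq 0}\to\mathbb{R}$ that is (i) strictly increasing, (ii) continuous, (iii) concave, and (iv) such that $g(x)=\psi(e^{x})$ is convex as a function of $x\in\mathbb{R}$. For a neighbor function $\psi$, a number $\sigma\geq 0$ and $y\geq 0$, the uncertainty interval around $y$ is $I_{\psi,\sigma}(y)=\big[\psi^{-1}(\max(\psi(0),\psi(y)-\sigma)),\ \psi^{-1}(\psi(y)+\sigma)\big]$. *)

(* Defs.v *)
From HB Require Import structures.
From mathcomp Require Import all_boot all_order all_algebra.
From mathcomp Require Import all_classical all_reals all_analysis.
Set Implicit Arguments. Unset Strict Implicit. Unset Printing Implicit Defensive.
Import Order.TTheory GRing.Theory Num.Theory.
Import numFieldNormedType.Exports.
Local Open Scope classical_set_scope.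
Local Open Scope ring_scope.

Section Defs.
Variable R : realType.

(* A neighbor function psi : R_{>=0} -> R, represented as a function R -> R
   whose behaviour on negative arguments is irrelevant. *)
Definition neighbor_function (psi : R -> R) : Prop :=
  [/\
      (forall x y, 0 <= x -> x < y -> psi x < psi y),
      {within [set x : R | 0 <= x], continuous psi},
      (forall x y t, 0 <= x -> 0 <= y -> 0 <= t <= 1 ->
         t * psi x + (1 - t) * psi y <= psi (t * x + (1 - t) * y)) &
      (forall x y t, 0 <= t <= 1 ->
         psi (expR (t * x + (1 - t) * y)) <= t * psi (expR x) + (1 - t) * psi (expR y))].

(* The inverse psi^{-1} of psi : R_{>=0} -> R (chosen by classical choice;
   it is the unique preimage in [0,+oo) when one exists). *)
Definition psi_inv (psi : R -> R) (t : R) : R :=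
  xget 0 [set z : R | 0 <= z /\ psi z = t].

Definition uncertainty_interval (psi : R -> R) (sigma y : R) : set R :=
  [set z : R | psi_inv psi (Num.max (psi 0) (psi y - sigma)) <= z
               /\ z <= psi_inv psi (psi y + sigma)].

Definition cont_diff_ae (psi : R -> R) : Prop :=
  exists N : set R, (@lebesgue_measure R).-negligible N /\
    forall x, 0 < x -> ~ N x ->
      derivable psi x 1 /\
      (forall e : R, 0 < e -> exists2 d : R, 0 < d &
         forall y, 0 < y -> `|y - x| < d -> ~ N y ->
           `|derive1 psi y - derive1 psi x| < e).

Definition psi_star (sA sB : R) (psiA psiB : R -> R) (x : R) : R :=
  Rintegral (@lebesgue_measure R) `[0, x]%classic
    (fun s => Num.max (sA^-1 * derive1 psiA s) (sB^-1 * derive1 psiB s)).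

End Defs.

(* Main.v *)
Require Import Defs.
From HB Require Import structures.
From mathcomp Require Import all_boot all_order all_algebra.
From mathcomp Require Import all_classical all_reals all_analysis.
From mathcomp Require Import measurable_realfun ring lra.
Import Order.TTheory GRing.Theory Num.Theory.
Import numFieldNormedType.Exports.
Local Open Scope classical_set_scope.
Local Open Scope ring_scope.

(** On (0, +oo) a neighbor function psi is differentiable at every point: at x,
   concavity of psi makes the right derivative at most the left one, and
   convexity of psi \o exp gives the reverse inequality. Conversely a function
   continuous on [0, +oo) and differentiable on (0, +oo) is a neighbor function
   as soon as its derivative m is positive, m is nonincreasing and x * m x is
   nondecreasing. These three conditions are stable under positive scaling and
   under maxima, hence psi_star is a neighbor function. Its increments dominate
   those of psiA / sA and psiB / sB, which gives the inclusions of the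
   intervals. *)

Set Implicit Arguments.
Unset Strict Implicit.
Unset Printing Implicit Defensive.

(** * Real functions: slopes, concavity from the derivative, integrability of a derivative *)

Section RealFunctions.
Context {R : realType}.
Implicit Types (f g df : R -> R) (a b c d x y z t : R).

(** The bound tends to 0 because [g x * x / z] tends to [g x]. It covers every [g] whose value at
    [z] lies between [g x] and [g x * x / z]. *)
Lemma continuous_at_ratio_bound g x : 0 < x ->
  (forall z, 0 < z -> `|g z - g x| <= `|g x * x / z - g x|) ->
  {for x, continuous g}.
Proof.
move=> x0 gx.
have h : g x * x / z @[z --> x] --> g x.
  rewrite -[X in _ --> X](mulfK (lt0r_neq0 x0)).
  by apply: cvgMl_tmp; apply: inv_continuous; exact: lt0r_neq0.
apply/cvgrPdist_lt => e e0.
move/cvgrPdist_lt : h => /(_ e e0) h.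
near=> z.
rewrite distrC (le_lt_trans (gx _ _))//.
  by near: z; exact: lt_nbhsr.
by rewrite distrC; near: z.
Unshelve. all: by end_near. Qed.

(** Write [f z - f a = g z * (z - a)] with [g] continuous at [a]. The concavity inequality divided
    by [t] bounds [f b - f a] by [g (t * b + (1 - t) * a) * (b - a)]; then [t] tends to 0 from the
    right. *)
Lemma le_tangent f a b d : is_derive a 1 f d ->
  (forall t, 0 <= t <= 1 -> t * f b + (1 - t) * f a <= f (t * b + (1 - t) * a)) ->
  f b - f a <= d * (b - a).
Proof.
move=> /is_derive1_caratheodory[g [fg cg <-]] cf.
have cvg_ab : t * b + (1 - t) * a @[t --> (0 : R)] --> 0 * b + (1 - 0) * a.
  by apply: cvgD; apply: cvgMr_tmp => //; apply: cvgB => //; exact: cvg_cst.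
rewrite mul0r add0r subr0 mul1r in cvg_ab.
have cvg_g : g (t * b + (1 - t) * a) * (b - a) @[t --> 0^'+] --> g a * (b - a).
  apply: cvgMr_tmp; apply: cvg_at_right_filter.
  exact: (cvg_comp _ _ cvg_ab cg).
rewrite -(cvg_lim _ cvg_g)//; apply: limr_ge; first by apply/cvg_ex; eexists; exact: cvg_g.
near=> t.
have t0 : 0 < t by near: t; exact: nbhs_right_gt.
have t1 : t <= 1 by near: t; apply: nbhs_right_le.
have /cf : 0 <= t <= 1 by rewrite (ltW t0).
have := fg (t * b + (1 - t) * a); move: (f _) (g _) => F G FG Ht.
rewrite -(ler_pM2l t0); nra.
Unshelve. all: by end_near. Qed.

Lemma concave_chord f a b c :
  (forall t, 0 <= t <= 1 -> t * f a + (1 - t) * f c <= f (t * a + (1 - t) * c)) ->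
  a < b -> b < c -> (f c - f b) * (b - a) <= (f b - f a) * (c - b).
Proof.
move=> cf ab bc.
have ac : 0 < c - a by lra.
pose t := (c - b) / (c - a).
have tE : t * (c - a) = c - b by rewrite /t divfK ?gt_eqF.
have t0 : 0 <= t by rewrite /t divr_ge0//; lra.
have t1 : t <= 1 by rewrite /t ler_pdivrMr//; lra.
have := cf t; rewrite t0 t1 => /(_ isT).
have -> : t * a + (1 - t) * c = b by lra.
rewrite -(ler_pM2r ac).
have -> : (t * f a + (1 - t) * f c) * (c - a) =
  (t * (c - a)) * f a + (c - a - t * (c - a)) * f c by ring.
rewrite tE; lra.
Qed.

(** By the mean value theorem the slopes on the two sides of the intermediate point are values of
    [df] at some [x < y]. The weights 0 and 1 are set apart because one side then degenerates. *)
Lemma derive_nonincreasing_concave f df a b t : a < b ->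
  (forall x, x \in `]a, b[ -> is_derive x 1 f (df x)) ->
  (forall x y, a < x -> x <= y -> y < b -> df y <= df x) ->
  {within `[a, b], continuous f} -> 0 <= t <= 1 ->
  t * f a + (1 - t) * f b <= f (t * a + (1 - t) * b).
Proof.
move=> ab fdf df_ni cf /andP[].
rewrite le_eqVlt => /predU1P[<- _|t0]; first by rewrite !mul0r !add0r !subr0 !mul1r.
rewrite le_eqVlt => /predU1P[->|t1]; first by rewrite subrr !mul0r !addr0 !mul1r.
set c := t * a + (1 - t) * b.
have ac : a < c by rewrite /c; nra.
have cb : c < b by rewrite /c; nra.
have ca : c - a = (1 - t) * (b - a) by rewrite /c; ring.
have bc : b - c = t * (b - a) by rewrite /c; ring.
clearbody c.
have mvt u v : a <= u -> u < v -> v <= b ->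
    exists2 x, x \in `]u, v[ & f v - f u = df x * (v - u).
  move=> au uv vb.
  have duv x : x \in `]u, v[ -> is_derive x 1 f (df x).
    move=> /andP[ux xv]; apply: fdf; rewrite in_itv/=.
    by rewrite (le_lt_trans au ux) (lt_le_trans xv vb).
  have cuv : {within `[u, v], continuous f}.
    by apply: continuous_subspaceW cf; apply: subset_itv; rewrite bnd_simp.
  exact: (MVT uv duv cuv).
have [x] := mvt _ _ (lexx a) ac (ltW cb).
rewrite in_itv/= => /andP[ax xc] fac.
have [y] := mvt _ _ (ltW ac) cb (lexx b).
rewrite in_itv/= => /andP[cy yb] fcb.
have dxy : df y <= df x by apply: df_ni => //; rewrite ltW// (lt_trans xc).
rewrite {}ca in fac; rewrite {}bc in fcb.
have : 0 <= (df x - df y) * ((1 - t) * t * (b - a)).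
  by rewrite mulr_ge0 ?subr_ge0// !mulr_ge0//; lra.
have : (1 - t) * (f b - f c) = (1 - t) * (df y * (t * (b - a))) by rewrite fcb.
have : t * (f c - f a) = t * (df x * ((1 - t) * (b - a))) by rewrite fac.
lra.
Qed.

Lemma concave_on_lt (D : set R) f :
  (forall x y t, D x -> D y -> x < y -> 0 <= t <= 1 ->
    t * f x + (1 - t) * f y <= f (t * x + (1 - t) * y)) ->
  forall x y t, D x -> D y -> 0 <= t <= 1 ->
    t * f x + (1 - t) * f y <= f (t * x + (1 - t) * y).
Proof.
move=> cf x y t Dx Dy t01; have [xy|yx|->] := ltgtP x y; first exact: cf.
  have t01' : 0 <= 1 - t <= 1 by lra.
  have := cf y x (1 - t) Dy Dx yx t01'.
  have -> : 1 - (1 - t) = t by ring.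
  by rewrite [t * f x + _]addrC [t * x + _]addrC.
by rewrite -!mulrDl addrC subrK !mul1r.
Qed.

(** Since [f] may be unbounded near 0, the fundamental theorem is applied on [[1 / (n + 1), b]]. The
    integral there is at most [F b - F 0], as [F] is nondecreasing, and monotone convergence extends
    the bound to []0, b]]. *)
Lemma derive_ge0_integrable (F f : R -> R) b : 0 < b ->
  {within `[0, b], continuous F} ->
  (forall x, 0 < x -> is_derive x 1 F (f x)) ->
  (forall x, 0 < x -> 0 <= f x) ->
  (forall x, 0 < x -> {for x, continuous f}) ->
  (@lebesgue_measure R).-integrable `[0, b] (EFin \o f).
Proof.
move=> b0 cF dF f0 cf.
have mf : measurable_fun (`]0, b] : set R) (EFin \o f).
  apply/measurable_EFinP; apply/measurable_fun_itv_bndo_bndcP.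
  apply: open_continuous_measurable_fun; first exact: interval_open.
  by move=> x; rewrite inE/= in_itv/= => /andP[x0 _]; exact: cf.
have mfa : measurable_fun (`]0, b] : set R) (abse \o (EFin \o f)).
  by apply: measurableT_comp.
(* Nothing is assumed about [f 0]: adding one point preserves measurability and does not change the
   integral. *)
apply/integrableP; split; first exact/emeasurable_fun_itv_obnd_cbndP.
rewrite -integral_itv_obnd_cbnd//.
suff : (\int[lebesgue_measure]_(x in `]0%R, b]) `|(EFin \o f) x| <= (F b - F 0)%:E)%E.
  by move=> /le_lt_trans; apply; rewrite ltry.
have F_nd x : 0 < x -> x <= b -> F 0 <= F x.
  move=> x0 xb; apply: (@ger0_derive1_ndecr _ F 0 b) => //; last exact: ltW.
  - by move=> y; rewrite in_itv/= => /andP[y0 _]; exact: (@ex_derive _ _ _ _ _ _ _ (dF _ y0)).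
  - move=> y; rewrite in_itv/= => /andP[y0 _].
    by rewrite derive1E (@derive_val _ _ _ _ _ _ _ (dF _ y0)) f0.
rewrite itv_open_bnd_bigcup.
set I := fun n : nat => _.
have subI n : I n `<=` `]0, b].
  move=> x; rewrite /I /= !in_itv/= add0r => /andP[nx ->]; rewrite andbT.
  by apply: lt_le_trans nx; rewrite invr_gt0.
have cvgI : (\int[lebesgue_measure]_(x in I n) `|(EFin \o f) x|)%E @[n --> \oo] -->
    (\int[lebesgue_measure]_(x in \bigcup_n I n) `|(EFin \o f) x|)%E.
  apply: ge0_nondecreasing_set_cvg_integral => //.
  - move=> i j ij; apply/subsetPset; apply: subset_itvr.
    by rewrite bnd_simp lerD2l lef_pV2 ?posrE// ler_nat.
  - by move=> i; exact: measurable_itv.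
  - by move=> i; apply: measurable_funS mfa.
rewrite -(cvg_lim _ cvgI)//; apply: lime_le.
  by apply/cvg_ex; eexists; exact: cvgI.
near=> n.
have n0 : 0 < n.+1%:R^-1 :> R by rewrite invr_gt0.
have nb : n.+1%:R^-1 < b by near: n; exact: near_infty_natSinv_lt (PosNum b0).
have cFx x : 0 < x -> {for x, continuous F}.
  move=> x0; apply: differentiable_continuous; apply/derivable1_diffP.
  exact: (@ex_derive _ _ _ _ _ _ _ (dF _ x0)).
have -> : (\int[lebesgue_measure]_(x in I n) `|(EFin \o f) x|)%E =
    (\int[lebesgue_measure]_(x in `[n.+1%:R^-1%R, b]) (f x)%:E)%E.
  rewrite /I add0r; apply: eq_integral => x; rewrite inE/= in_itv/= => /andP[nx _].
  by rewrite /= ger0_norm// f0// (lt_le_trans n0).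
rewrite (@continuous_FTC2 _ f F)//.
- by rewrite -EFinB lee_fin lerD2l lerN2 F_nd// ltW.
- apply: continuous_in_subspaceT => x; rewrite inE/= in_itv/= => /andP[nx _].
  by apply: cf; exact: lt_le_trans nx.
- split.
  + move=> x; rewrite in_itv/= => /andP[nx _].
    exact: (@ex_derive _ _ _ _ _ _ _ (dF _ (lt_trans n0 nx))).
  + by apply: cvg_at_right_filter; exact: cFx.
  + by apply: cvg_at_left_filter; exact: cFx.
- move=> x; rewrite in_itv/= => /andP[nx _].
  by rewrite derive1E (@derive_val _ _ _ _ _ _ _ (dF _ (lt_trans n0 nx))).
Unshelve. all: by end_near. Qed.

End RealFunctions.

(** * Neighbor functions: differentiability and the densities that are their derivatives *)

Section NeighborFunctions.
Context {R : realType}.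
Implicit Types (psi m : R -> R) (a b c d x y z t : R).

(** Here [ln x] is the midpoint of [ln y] and [ln z], so this is midpoint convexity of
    [psi \o expR]. *)
Lemma neighbor_geometric_mean psi x y z : neighbor_function psi ->
  0 < x -> 0 < y -> 0 < z -> y * z = x ^+ 2 -> psi x - psi y <= psi z - psi x.
Proof.
move=> [_ _ _ cvx] x0 y0 z0 yzx.
have h : 0 <= (2^-1 : R) <= 1 by lra.
have := cvx (ln y) (ln z) 2^-1 h.
have -> : 2^-1 * ln y + (1 - 2^-1) * ln z = ln x.
  have : ln (y * z) = ln (x ^+ 2) by rewrite yzx.
  rewrite lnM ?posrE// expr2 lnM ?posrE//; lra.
rewrite !lnK ?posrE//; lra.
Qed.

(* The slopes at x to the right are at most d and those to the left at least d,
   where d is the supremum of the former. The geometric mean inequality at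
   z * w = x ^+ 2 bounds the slope at z on the other side by d * x / z. *)
Lemma neighbor_is_derive psi x : neighbor_function psi -> 0 < x ->
  exists2 d, is_derive x 1 psi d &
    forall z, 0 <= z -> psi z - psi x <= d * (z - x).
Proof.
move=> npsi x0; have [_ _ ccv _] := npsi.
pose slope z := (psi z - psi x) / (z - x).
pose A : set R := slope @` [set z | x < z].
pose d := sup A.
have slopeE z : z != x -> psi z - psi x = slope z * (z - x).
  by move=> zx; rewrite /slope divfK// subr_eq0.
have slope_le y z : 0 <= y -> y < x -> x < z -> slope z <= slope y.
  move=> y0 yx xz.
  have := @concave_chord _ psi y x z (fun t => ccv y z t y0 (ltW (lt_trans x0 xz))) yx xz.
  rewrite -(opprB (psi y)) !slopeE ?(lt_eqF yx) ?(gt_eqF xz)//.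
  move: (slope y) (slope z) => p q h.
  have : 0 < (x - y) * (z - x) by rewrite mulr_gt0 ?subr_gt0.
  nra.
have A0 : A !=set0 by exists (slope (x + 1)), (x + 1) => //=; rewrite ltrDl.
have Aub u : 0 <= u -> u < x -> ubound A (slope u).
  by move=> u0 ux _ [v /= xv <-]; exact: slope_le.
have supA : has_sup A by split => //; exists (slope 0); exact: Aub.
have dr z : x < z -> slope z <= d by move=> xz; apply: (sup_upper_bound supA); exists z.
have dl y : 0 <= y -> y < x -> d <= slope y by move=> y0 yx; apply: ge_sup => //; exact: Aub.
exists d.
  apply/is_derive1_caratheodory.
  exists (fun z => if z == x then d else slope z); split; last by rewrite eqxx.
  - move=> z; case: eqVneq => [->|/slopeE//]; by rewrite !subrr mulr0.
  apply: continuous_at_ratio_bound => // z z0; rewrite eqxx.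
  have [->|zx] := eqVneq z x; first by rewrite subrr normr0.
  (* The point [w] mirrors [z] through [x] on the logarithmic scale; its distance to [x] is [x / z]
     times that of [z]. *)
  have w0 : 0 < x ^+ 2 / z by rewrite divr_gt0// exprn_gt0.
  have zw : z * (x ^+ 2 / z) = x ^+ 2 by rewrite mulrC divfK ?gt_eqF.
  set w := x ^+ 2 / z in w0 zw.
  have wx : w - x = x / z * (x - z).
    by rewrite /w; field; rewrite gt_eqF.
  have xz0 : 0 < x / z by rewrite divr_gt0.
  rewrite -mulrA; set r := x / z in wx xz0 *.
  case: (ltgtP z x) zx => // [zx|xz] _.
    have xw : x < w by rewrite -subr_gt0 wx mulr_gt0// subr_gt0.
    have := neighbor_geometric_mean npsi x0 z0 w0 zw.
    rewrite -(opprB (psi z)) !slopeE ?(lt_eqF zx) ?(gt_eqF xw)// wx => h.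
    have sw := dr _ xw; have sz := dl _ (ltW z0) zx.
    (* The chain is [d <= slope z <= slope w * r <= d * r], divided through by [x - z > 0]. *)
    suff : slope z <= d * r by move=> ?; rewrite !ger0_norm ?lerB//; lra.
    have zx0 : 0 < x - z by lra.
    rewrite -(ler_pM2r zx0); apply: (@le_trans _ _ (slope w * (r * (x - z)))); first by lra.
    by rewrite -(mulrA d) ler_wpM2r// mulr_ge0// ltW.
  have xw : w < x by rewrite -subr_gt0 -opprB wx -mulrN opprB mulr_gt0// subr_gt0.
  have wz : w * z = x ^+ 2 by rewrite mulrC.
  have := neighbor_geometric_mean npsi x0 w0 z0 wz.
  rewrite -(opprB (psi w)) !slopeE ?(lt_eqF xw) ?(gt_eqF xz)// wx => h.
  have sz := dr _ xz; have sw := dl _ (ltW w0) xw.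
  (* Mirrored chain: [d * r <= slope w * r <= slope z <= d]. *)
  suff : d * r <= slope z by move=> ?; rewrite !ler0_norm; lra.
  have zx0 : 0 < z - x by lra.
  rewrite -(ler_pM2r zx0); apply: (@le_trans _ _ (slope w * (r * (z - x)))); last by lra.
  by rewrite -(mulrA d) ler_wpM2r// mulr_ge0// ltW.
move=> z z0; have [zx|xz|->] := ltgtP z x; last by rewrite !subrr mulr0.
  by rewrite slopeE ?lt_eqF// ler_nM2r ?subr_lt0// dl.
by rewrite slopeE ?gt_eqF// ler_pM2r ?subr_gt0// dr.
Qed.

(* The derivatives of neighbor functions are the densities integrable at 0. *)
Definition neighbor_density m :=
  [/\ forall x, 0 < x -> 0 < m x,
      forall x y, 0 < x -> x <= y -> m y <= m x &
      forall x y, 0 < x -> x <= y -> x * m x <= y * m y].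

(** The two monotonicity conditions place [m z] between [m x] and [x * m x / z], on either side of
    [x]. *)
Lemma neighbor_density_continuous m x : neighbor_density m -> 0 < x ->
  {for x, continuous m}.
Proof.
move=> [_ m_ni xm_nd] x0; apply: continuous_at_ratio_bound => // z z0.
have [xz|zx] := leP x z.
  have := m_ni _ _ x0 xz; have := xm_nd _ _ x0 xz.
  rewrite [m x * x]mulrC => h1 h2.
  have : x * m x / z <= m z by rewrite ler_pdivrMr// [m z * z]mulrC.
  move: (x * m x / z) => r h3.
  by rewrite ler0_norm ?subr_le0// ler0_norm ?lerN2 ?lerD2r// subr_le0 (le_trans h3).
have := m_ni _ _ z0 (ltW zx); have := xm_nd _ _ z0 (ltW zx).
rewrite [m x * x]mulrC => h1 h2.
have : m z <= x * m x / z by rewrite ler_pdivlMr// [m z * z]mulrC.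
move: (x * m x / z) => r h3.
by rewrite ger0_norm ?subr_ge0// ger0_norm ?lerD2r// subr_ge0 (le_trans _ h3).
Qed.

Lemma neighbor_density_scale m c : 0 < c -> neighbor_density m ->
  neighbor_density (fun x => c * m x).
Proof.
move=> c0 [m0 m_ni xm_nd]; split.
- by move=> x x0; rewrite mulr_gt0// m0.
- by move=> x y x0 xy; rewrite ler_pM2l// m_ni.
- by move=> x y x0 xy; rewrite !(mulrCA _ c) ler_pM2l// xm_nd.
Qed.

Lemma neighbor_density_max m1 m2 : neighbor_density m1 -> neighbor_density m2 ->
  neighbor_density (fun x => Num.max (m1 x) (m2 x)).
Proof.
move=> [m10 m1_ni xm1_nd] [m20 m2_ni xm2_nd]; split.
- by move=> x x0; rewrite lt_max m10.
- move=> x y x0 xy; rewrite ge_max !le_max m1_ni//= m2_ni//.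
  by rewrite orbT.
- move=> x y x0 xy; have y0 := lt_le_trans x0 xy.
  rewrite (maxr_pMr _ _ (ltW x0)) (maxr_pMr _ _ (ltW y0)) ge_max !le_max xm1_nd//= xm2_nd//.
  by rewrite orbT.
Qed.

Lemma neighbor_is_derive1 psi x : neighbor_function psi -> 0 < x ->
  is_derive x 1 psi (derive1 psi x).
Proof.
move=> npsi x0; have [d dpsi _] := neighbor_is_derive npsi x0.
by rewrite derive1E derive_val.
Qed.

Lemma neighbor_le_tangent psi x z : neighbor_function psi -> 0 < x -> 0 <= z ->
  psi z - psi x <= derive1 psi x * (z - x).
Proof.
move=> npsi x0 z0; have [d dpsi h] := neighbor_is_derive npsi x0.
by rewrite derive1E derive_val h.
Qed.

(** Positivity comes from the tangent at [x] evaluated at [x + 1]. Adding the tangent inequalities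
    at [x] and [y] gives the first monotonicity; doing so for the concave function
    [- (psi \o expR)], whose derivative at [ln z] is [- (derive1 psi z * z)], gives the second. *)
Lemma neighbor_density_derive1 psi : neighbor_function psi ->
  neighbor_density (derive1 psi).
Proof.
move=> npsi; have [inc _ _ cvx] := npsi; split.
- move=> x x0; have := neighbor_le_tangent npsi x0 (ltW (addr_gt0 x0 ltr01)).
  rewrite [x + 1 - x]addrAC subrr add0r mulr1; apply: lt_le_trans.
  by rewrite subr_gt0 inc ?ltrDl// ltW.
- move=> x y x0; rewrite le_eqVlt => /predU1P[->//|xy].
  have y0 := lt_trans x0 xy.
  have := neighbor_le_tangent npsi x0 (ltW y0).
  have := neighbor_le_tangent npsi y0 (ltW x0).
  move=> h1 h2; have xy0 : 0 < y - x by lra.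
  by rewrite -(ler_pM2r xy0); lra.
- move=> x y x0; rewrite le_eqVlt => /predU1P[->//|xy].
  have y0 := lt_trans x0 xy.
  pose h : R -> R := - (psi \o expR).
  have dh z : 0 < z -> is_derive (ln z) 1 h (- (derive1 psi z * z)).
    move=> z0; apply: is_deriveN; apply: is_derive1_comp.
      by rewrite lnK ?posrE//; exact: neighbor_is_derive1.
    by have := is_derive_expR (ln z); rewrite lnK ?posrE.
  have ch u v : forall t, 0 <= t <= 1 -> t * h u + (1 - t) * h v <= h (t * u + (1 - t) * v).
    by move=> t t01; have := cvx u v t t01; rewrite /h !fctE; lra.
  have lnxy : 0 < ln y - ln x by rewrite subr_gt0 ltr_ln ?posrE.
  have := le_tangent (dh _ x0) (ch (ln y) (ln x)).
  have := le_tangent (dh _ y0) (ch (ln x) (ln y)).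
  by move=> h1 h2; rewrite -(ler_pM2r lnxy); lra.
Qed.

Lemma neighbor_continuous_segment psi a b : neighbor_function psi -> 0 <= a ->
  {within `[a, b], continuous psi}.
Proof.
move=> [_ cpsi _ _] a0; apply: continuous_subspaceW cpsi => x /=.
by rewrite in_itv/= => /andP[/(le_trans a0)].
Qed.

(** The number [derive1 psi 0] depends on arbitrary values of [psi] at negative arguments, but a
    single point does not affect integrability. *)
Lemma neighbor_derive1_integrable psi b : neighbor_function psi -> 0 < b ->
  (@lebesgue_measure R).-integrable `[0, b] (EFin \o derive1 psi).
Proof.
move=> npsi b0; have dpsi := neighbor_density_derive1 npsi.
apply: (@derive_ge0_integrable _ psi) => //.
- exact: neighbor_continuous_segment.
- by move=> x; exact: neighbor_is_derive1.
- by move=> x x0; case: dpsi => /(_ _ x0)/ltW.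
- by move=> x; exact: neighbor_density_continuous.
Qed.

(** * Primitives of integrable densities *)

Section Primitive.
Variable m : R -> R.
Hypothesis dm : neighbor_density m.
Hypothesis im : forall b, 0 < b ->
  (@lebesgue_measure R).-integrable `[0, b] (EFin \o m).

Let F x := Rintegral (@lebesgue_measure R) `[0, x] m.

Lemma is_derive_primitive x : 0 < x -> is_derive x 1 F (m x).
Proof.
(* The right end [x + 1] makes [x] an interior point of the integration range. *)
move=> x0; have x1 : x < x + 1 by rewrite ltrDl.
have [dF F'] := continuous_FTC1_closed x1 (im (lt_trans x0 x1)) x0
  (neighbor_density_continuous dm x0).
by apply: DeriveDef => //; rewrite -derive1E.
Qed.

(** Differentiability settles the points [x > 0]. At 0, where [m] may blow up, right continuity
    comes from continuity of the integral of an integrable function in its upper bound. *)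
Lemma continuous_primitive : {within [set x : R | 0 <= x], continuous F}.
Proof.
rewrite -set_itvcy; apply/continuous_within_itvcyP; split.
  move=> x; rewrite in_itv/= andbT => x0.
  apply: differentiable_continuous; apply/derivable1_diffP.
  exact: (@ex_derive _ _ _ _ _ _ _ (is_derive_primitive x0)).
have := parameterized_integral_continuous (@ler01 R) (im ltr01).
by move=> /(continuous_within_itvP _ ltr01)[].
Qed.

Lemma neighbor_primitive : neighbor_function F.
Proof.
have [m0 m_ni xm_nd] := dm.
have cF a b : 0 <= a -> {within `[a, b], continuous F}.
  move=> a0; apply: continuous_subspaceW continuous_primitive => x /=.
  by rewrite in_itv/= => /andP[/(le_trans a0)].
split.
- move=> x y x0 xy.
  have dF z : z \in `]x, y[ -> is_derive z 1 F (m z).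
    by rewrite in_itv/= => /andP[xz _]; apply: is_derive_primitive; exact: le_lt_trans xz.
  have [z] := MVT xy dF (cF x y x0).
  rewrite in_itv/= => /andP[xz _] Fxy.
  by rewrite -subr_gt0 Fxy mulr_gt0 ?subr_gt0// m0// (le_lt_trans x0).
- exact: continuous_primitive.
- apply: (@concave_on_lt _ [set x | 0 <= x]) => x y t /= x0 y0 xy t01.
  apply: (@derive_nonincreasing_concave _ F m) => //.
  + by move=> z; rewrite in_itv/= => /andP[xz _]; apply: is_derive_primitive; exact: le_lt_trans xz.
  + by move=> u v xu uv _; apply: m_ni => //; exact: le_lt_trans xu.
  + exact: cF.
(* Convexity of [F \o expR] is concavity of its opposite, whose derivative [dh] is nonincreasing
   because [x * m x] is nondecreasing. *)
- pose h : R -> R := - (F \o expR).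
  pose dh : R -> R := fun x => - (m (expR x) * expR x).
  have dhE x : is_derive x 1 h (dh x).
    by apply: is_deriveN; apply: is_derive1_comp; exact: is_derive_primitive (expR_gt0 x).
  move=> x y t t01.
  suff : t * h x + (1 - t) * h y <= h (t * x + (1 - t) * y) by rewrite /h !fctE; lra.
  apply: (@concave_on_lt _ setT) => // {x y t t01} x y t _ _ xy t01.
  apply: (@derive_nonincreasing_concave _ h dh) => //.
  + move=> u v _ uv _; rewrite /dh lerN2 ![m _ * _]mulrC xm_nd ?expR_gt0//.
    by rewrite ler_expR.
  + apply: derivable_within_continuous => u _.
    exact: (@ex_derive _ _ _ _ _ _ _ (dhE u)).
Qed.

End Primitive.

(** * Comparison of increments and of uncertainty intervals *)

Lemma neighbor_derive1_le_increment psi1 psi2 c x y :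
  neighbor_function psi1 -> neighbor_function psi2 ->
  (forall z, 0 < z -> c * derive1 psi1 z <= derive1 psi2 z) ->
  0 <= x -> x <= y -> c * (psi1 y - psi1 x) <= psi2 y - psi2 x.
Proof.
move=> n1 n2 le12 x0; rewrite le_eqVlt => /predU1P[->|xy].
  by rewrite !subrr mulr0.
(* The mean value theorem needs the derivative of [h] only inside the segment, so [x = 0] is
   allowed. *)
pose h : R -> R := psi2 - c \*: psi1.
pose dh : R -> R := fun z => derive1 psi2 z - c *: derive1 psi1 z.
have dhE z : z \in `]x, y[ -> is_derive z 1 h (dh z).
  rewrite in_itv/= => /andP[xz _]; have z0 := le_lt_trans x0 xz.
  by apply: is_deriveB; [|apply: is_deriveZ]; exact: neighbor_is_derive1.
have ch : {within `[x, y], continuous h}.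
  have c1 := neighbor_continuous_segment (b := y) n1 x0.
  have c2 := neighbor_continuous_segment (b := y) n2 x0.
  move=> z; apply: cvgB; first exact: c2.
  by apply: cvgZl_tmp; exact: c1.
have [z] := MVT xy dhE ch.
rewrite in_itv/= => /andP[xz _] hxy; have z0 := le_lt_trans x0 xz.
have : 0 <= dh z * (y - x) by rewrite mulr_ge0 ?subr_ge0 ?le12// ltW.
have hE u : h u = psi2 u - c * psi1 u by [].
by rewrite -hxy !hE; lra.
Qed.

(** Convexity makes [psi \o expR] stay above its chord through 0 and 1 beyond 1, hence unbounded;
    the intermediate value theorem then applies. *)
Lemma neighbor_surj psi t : neighbor_function psi -> psi 0 <= t ->
  exists2 z, 0 <= z & psi z = t.
Proof.
move=> npsi t0; have [inc _ _ cvx] := npsi.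
have d0 : 0 < psi (expR 1) - psi (expR 0).
  by rewrite subr_gt0 inc ?expR_ge0// ltr_expR.
have [s [s1 ts]] : exists s, 1 <= s /\ t - psi (expR 0) <= s * (psi (expR 1) - psi (expR 0)).
  (* At the quotient the chord through 0 and 1 reaches height [t]; the maximum with 1 makes [s^-1]
     an admissible weight. *)
  exists (Num.max 1 ((t - psi (expR 0)) / (psi (expR 1) - psi (expR 0)))).
  by split; [|rewrite -ler_pdivrMr//]; rewrite le_max lexx ?orbT.
have s0 : 0 < s by lra.
have ht : psi 0 <= t <= psi (expR s).
  have s01 : 0 <= s^-1 <= 1 by rewrite invr_ge0 (ltW s0) invf_le1.
  have := cvx s 0 _ s01.
  rewrite mulr0 addr0 mulVf ?gt_eqF// t0/= => h.
  suff : s * (psi (expR 1) - psi (expR 0)) <= psi (expR s) - psi (expR 0) by lra.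
  rewrite mulrC -ler_pdivlMr// [_ / s]mulrC; lra.
have psi0s : psi 0 <= psi (expR s) by case/andP: ht; exact: le_trans.
have cpsi := neighbor_continuous_segment (b := expR s) npsi (lexx 0).
have [|z] := @IVT _ _ _ _ t (expR_ge0 s) cpsi; first by rewrite min_l ?max_r.
by rewrite in_itv/= => /andP[z0 _] zt; exists z.
Qed.

(** For [y] and [sigma] nonnegative, both arguments of [psi_inv] in [uncertainty_interval] are at
    least [psi 0], so the default value of [xget] does not interfere. *)
Lemma psi_invP psi t : neighbor_function psi -> psi 0 <= t ->
  0 <= psi_inv psi t /\ psi (psi_inv psi t) = t.
Proof.
move=> npsi t0; have [z z0 zt] := neighbor_surj npsi t0.
by have := @xgetPex _ 0 [set z : R | 0 <= z /\ psi z = t]; apply; exists z.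
Qed.

(** Relative to its allowance [s2], [psi2] varies at least as fast as [psi1] relative to [s1], so it
    exhausts its allowance no farther from [x]. Each pair of ends is compared by contradiction. *)
Lemma uncertainty_interval_subset psi1 psi2 s1 s2 x :
  neighbor_function psi1 -> neighbor_function psi2 -> 0 < s1 -> 0 < s2 -> 0 <= x ->
  (forall y z, 0 <= y -> y <= z -> s2 * (psi1 z - psi1 y) <= s1 * (psi2 z - psi2 y)) ->
  uncertainty_interval psi2 s2 x `<=` uncertainty_interval psi1 s1 x.
Proof.
move=> n1 n2 s10 s20 x0 le12.
have [inc1 _ _ _] := n1; have [inc2 _ _ _] := n2.
have nd1 y z : 0 <= y -> y <= z -> psi1 y <= psi1 z.
  by move=> y0; rewrite le_eqVlt => /predU1P[->//|yz]; rewrite ltW// inc1.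
have nd2 y z : 0 <= y -> y <= z -> psi2 y <= psi2 z.
  by move=> y0; rewrite le_eqVlt => /predU1P[->//|yz]; rewrite ltW// inc2.
have p1x := nd1 _ _ (lexx 0) x0; have p2x := nd2 _ _ (lexx 0) x0.
move=> z [/= lo hi]; split.
  apply: le_trans lo.
  have [|l10 l1E] := @psi_invP psi1 (Num.max (psi1 0) (psi1 x - s1)) n1.
    by rewrite le_max lexx.
  have [|l20 l2E] := @psi_invP psi2 (Num.max (psi2 0) (psi2 x - s2)) n2.
    by rewrite le_max lexx.
  move: (psi_inv psi1 _) (psi_inv psi2 _) l10 l20 l1E l2E => u1 u2 u10 u20 u1E u2E.
  rewrite leNgt; apply/negP => u21.
  have u10' : psi1 0 < psi1 u1 by apply: inc1 => //; exact: le_lt_trans u21.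
  (* Since [u1 > u2 >= 0], the left end for [psi1] is not truncated at [psi1 0]. *)
  have {}u1E : psi1 u1 = psi1 x - s1.
    have [h|/ltW h] := leP (psi1 0) (psi1 x - s1); first by rewrite u1E max_r.
    by move: u10'; rewrite u1E max_l// ltxx.
  have u2x : u2 <= x.
    rewrite leNgt; apply/negP => xu2.
    by have := inc1 _ _ x0 (lt_trans xu2 u21); lra.
  have := le12 _ _ u20 u2x; have := inc1 _ _ u20 u21.
  have : psi2 x - s2 <= psi2 u2 by rewrite u2E le_max lexx orbT.
  move=> h1 h2 h3.
  (* From [u2] to [x], [psi2] varies by at most [s2] but [psi1] by more than [s1], against
     [le12]. *)
  have : s1 * (psi2 x - psi2 u2) <= s1 * s2 by rewrite ler_pM2l//; lra.
  have : s2 * s1 < s2 * (psi1 x - psi1 u2) by rewrite ltr_pM2l//; lra.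
  by lra.
apply: (le_trans hi).
have [|r10 r1E] := @psi_invP psi1 (psi1 x + s1) n1; first by lra.
have [|r20 r2E] := @psi_invP psi2 (psi2 x + s2) n2; first by lra.
move: (psi_inv psi1 _) (psi_inv psi2 _) r10 r20 r1E r2E => u1 u2 u10 u20 u1E u2E.
rewrite leNgt; apply/negP => u12.
have xu1 : x <= u1.
  by rewrite leNgt; apply/negP => u1x; have := inc1 _ _ u10 u1x; lra.
have := le12 _ _ x0 xu1; have := inc2 _ _ u10 u12.
move=> h1 h2.
(* From [x] to [u1], [psi1] varies by exactly [s1] but [psi2] by less than [s2]. *)
have : s1 * (psi2 u1 - psi2 x) < s1 * s2 by rewrite ltr_pM2l//; lra.
have : s2 * s1 = s2 * (psi1 u1 - psi1 x) by congr *%R; lra.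
by lra.
Qed.

(** The exceptional set is empty: the derivative exists and is continuous at every positive
    point. *)
Lemma neighbor_cont_diff_ae psi : neighbor_function psi -> cont_diff_ae psi.
Proof.
move=> npsi; exists set0; split; first exact: negligible_set0.
move=> x x0 _; split; first exact: (@ex_derive _ _ _ _ _ _ _ (neighbor_is_derive1 npsi x0)).
move=> e e0.
have /cvgrPdist_lt/(_ e e0) := neighbor_density_continuous (neighbor_density_derive1 npsi) x0.
move=> /nbhs_ballP[d /= d0 dP]; exists d => // y _ yx _.
by rewrite distrC; apply: dP; rewrite /ball/= distrC.
Qed.

End NeighborFunctions.

Theorem theorem5p8 (R : realType) (psiA psiB : R -> R) (sA sB : R) :
  neighbor_function psiA -> neighbor_function psiB -> 0 < sA -> 0 < sB ->
  [/\ cont_diff_ae psiA, cont_diff_ae psiB,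
      neighbor_function (psi_star sA sB psiA psiB) &
      forall x : R, 0 <= x ->
        uncertainty_interval (psi_star sA sB psiA psiB) 1 x
          `<=` uncertainty_interval psiA sA x /\
        uncertainty_interval (psi_star sA sB psiA psiB) 1 x
          `<=` uncertainty_interval psiB sB x].
Proof.
move=> nA nB sA0 sB0.
pose mA x := sA^-1 * derive1 psiA x; pose mB x := sB^-1 * derive1 psiB x.
pose m x := Num.max (mA x) (mB x).
have dA : neighbor_density mA.
  by apply: neighbor_density_scale; [rewrite invr_gt0|exact: neighbor_density_derive1].
have dB : neighbor_density mB.
  by apply: neighbor_density_scale; [rewrite invr_gt0|exact: neighbor_density_derive1].
have dm : neighbor_density m := neighbor_density_max dA dB.
have im b : 0 < b -> (@lebesgue_measure R).-integrable `[0, b] (EFin \o m).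
  move=> b0.
  have iA : (@lebesgue_measure R).-integrable `[0, b] (EFin \o mA).
    exact: (integrableZl _ _ (neighbor_derive1_integrable nA b0)).
  have iB : (@lebesgue_measure R).-integrable `[0, b] (EFin \o mB).
    exact: (integrableZl _ _ (neighbor_derive1_integrable nB b0)).
  have mm : measurable_fun `[0, b] m.
    apply: measurable_maxr; apply/measurable_EFinP.
      exact: measurable_int iA.
    exact: measurable_int iB.
  (* Integrability of [m] follows by domination, the absolute value of a maximum being at most the
     sum of the absolute values. *)
  have iAB : (@lebesgue_measure R).-integrable `[0, b]
      ((abse \o (EFin \o mA)) \+ (abse \o (EFin \o mB)))%E.
    by apply: integrableD; [exact: measurable_itv|exact: integrable_abse..].
  apply: le_integrable iAB; [exact: measurable_itv|exact/measurable_EFinP|].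
  move=> x _ /=; rewrite lee_fin [leRHS]ger0_norm ?addr_ge0//.
  by rewrite /m; have [_|_] := leP (mA x) (mB x); rewrite ?lerDl ?lerDr normr_ge0.
have nS : neighbor_function (psi_star sA sB psiA psiB) by exact: (neighbor_primitive dm im).
have dS z : 0 < z -> derive1 (psi_star sA sB psiA psiB) z = m z.
  by move=> z0; rewrite derive1E (@derive_val _ _ _ _ _ _ _ (is_derive_primitive dm im z0)).
split; [exact: neighbor_cont_diff_ae|exact: neighbor_cont_diff_ae|exact: nS|].
move=> x x0; split; apply: uncertainty_interval_subset => // y z y0 yz.
  (* With allowance 1 for [psi_star], the comparison of increments reduces to [mA <= m] on the
     positive reals. *)
  rewrite mul1r -ler_pdivrMl//; apply: neighbor_derive1_le_increment => // w w0.
  by rewrite dS// le_max lexx.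
rewrite mul1r -ler_pdivrMl//; apply: neighbor_derive1_le_increment => // w w0.
by rewrite dS// le_max lexx orbT.
Qed.
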